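(* Consider a homogeneous weighted stochastic block model with $K\ge 2$ communities, each of size $n$ (vertex set $\{1,\dots,nK\}$), where each pair of vertices independently receives a weight distributed as $p_n$ if both endpoints lie in the same community and as $q_n$ otherwise. Let $F$ be the event that the maximum likelihood estimator of the community assignment fails (i.e. does not recover the true partition up to relabeling of communities). Then \[ \mathbb{P}(F)\le \sum_{m=1}^{\lfloor n/2\rfloor}\min\Big\{\Big(\frac{enK^2}{m}\Big)^m,\,K^{nK}\Big\}e^{(-nm+m^2)I}+\sum_{m=\lfloor n/2\rfloor+1}^{nK}\min\Big\{\Big(\frac{enK^2}{m}\Big)^m,\,K^{nK}\Big\}e^{-\frac{2mn}{9}I}, \] where $I$ is the Renyi divergence of order $\tfrac12$ between $p_n$ and $q_n$. In particular, if $\liminf_{n\to\infty}\frac{nI}{\log n}>1$, then the maximum likelihood estimator succeeds with probability converging to $1$ as $n\to\infty$.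
   Context: The Renyi divergence of order $\tfrac12$ is $I=-2\log\int\sqrt{p_n(x)q_n(x)}\,dx$ for continuous distributions on $\mathbb{R}$ and $I=-2\log\sum_{\ell\ge0}\sqrt{p_n(\ell)q_n(\ell)}$ for discrete distributions. *)

(* Defs.v *)
From HB Require Import structures.
From mathcomp Require Import all_boot all_order all_algebra.
From mathcomp Require Import all_classical all_reals all_analysis.
Set Implicit Arguments. Unset Strict Implicit. Unset Printing Implicit Defensive.
Import Order.TTheory GRing.Theory Num.Theory.
Import numFieldNormedType.Exports.
Local Open Scope classical_set_scope.
Local Open Scope ring_scope.

Section WSBM.
Context {R : realType} {dX : measure_display} {X : measurableType dX}.
Variable mu : {measure set X -> \bar R}.

(** [f] is a probability density with respect to the base measure [mu]
    (Lebesgue measure on R for the continuous case, counting measure on N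
    for the discrete case). *)
Definition is_density (f : X -> R) : Prop :=
  [/\ measurable_fun setT f, (forall x, 0 <= f x) &
      (\int[mu]_x (f x)%:E = 1)%E].

Definition bhattacharyya (p q : X -> R) : R :=
  fine (\int[mu]_x (Num.sqrt (p x * q x))%:E)%E.

Definition renyi_half (p q : X -> R) : \bar R :=
  if bhattacharyya p q == 0 then +oo%E
  else ((-2) * ln (bhattacharyya p q))%:E.

Context {d : measure_display} {Omega : measurableType d}.
Variable P : probability Omega R.

Definition has_density (Y : Omega -> X) (f : X -> R) : Prop :=
  measurable_fun setT Y /\
  forall A, measurable A -> P (Y @^-1` A) = (\int[mu]_(x in A) (f x)%:E)%E.

Definition edges_independent N (W : 'I_N -> 'I_N -> Omega -> X) : Prop :=
  forall (J : {set 'I_N * 'I_N}) (A : 'I_N * 'I_N -> set X),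
    {subset J <= [pred e : 'I_N * 'I_N | e.1 < e.2]%N} ->
    (forall e, measurable (A e)) ->
    P (\bigcap_(e in [set` J]) (W e.1 e.2 @^-1` A e)) =
    (\prod_(e in J) P (W e.1 e.2 @^-1` A e))%E.

End WSBM.

Definition balanced (n K : nat) (sigma : 'I_(n * K) -> 'I_K) : Prop :=
  forall k : 'I_K, #|[set i | sigma i == k]| = n.

Definition same_partition N K (s t : 'I_N -> 'I_K) : Prop :=
  forall i j, (s i == s j) = (t i == t j).

Definition likelihood {R : realType} {X : Type} N K (p q : X -> R)
    (sigma : 'I_N -> 'I_K) (w : 'I_N -> 'I_N -> X) : R :=
  \prod_(i < N) \prod_(j < N | (i < j)%N)
     (if sigma i == sigma j then p (w i j) else q (w i j)).

Definition wsbm {R : realType} {dX} {X : measurableType dX}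
    (mu : {measure set X -> \bar R}) {d} {Omega : measurableType d}
    (P : probability Omega R) (n K : nat)
    (W : 'I_(n * K) -> 'I_(n * K) -> Omega -> X) (p q : X -> R)
    (sigma0 : 'I_(n * K) -> 'I_K) : Prop :=
  [/\ balanced sigma0, is_density mu p, is_density mu q,
      (forall i j : 'I_(n * K), (i < j)%N ->
         has_density mu P (W i j) (if sigma0 i == sigma0 j then p else q)) &
      edges_independent P W].

(** Failure event of the MLE: some balanced assignment inducing a different
    partition has likelihood at least that of the truth (so the MLE is not
    guaranteed to return the true partition). *)
Definition mle_fail {R : realType} {X : Type} {Omega : Type} (n K : nat)
    (W : 'I_(n * K) -> 'I_(n * K) -> Omega -> X) (p q : X -> R)
    (sigma0 : 'I_(n * K) -> 'I_K) : set Omega :=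
  [set w | exists sigma : 'I_(n * K) -> 'I_K,
     [/\ balanced sigma, ~ same_partition sigma sigma0 &
         likelihood p q sigma0 (fun i j => W i j w)
           <= likelihood p q sigma (fun i j => W i j w)]].

(* Main.v *)
Require Import Defs.
From HB Require Import structures.
From mathcomp Require Import all_boot all_order all_algebra all_fingroup.
From mathcomp Require Import all_classical all_reals all_analysis.
From mathcomp Require Import measurable_realfun ring lra zify.
Import Order.TTheory GRing.Theory Num.Theory.
Import numFieldNormedType.Exports.
Local Open Scope ring_scope.

(** Write [b] for the Bhattacharyya coefficient of [p] and [q], so that
    [b = exp (- I / 2)].  By Chernoff's bound with parameter 1/2, an assignment
    [t] has likelihood at least that of the truth [s] with probability at most
    [b ^ M], where [M] is the number of pairs of vertices on whose togetherness
    [s] and [t] disagree.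

    Relabel [t] so that its Hamming distance [m] to [s] is minimal, and let
    [c a b] be the number of vertices labelled [a] by [s] and [b] by [t].  Since
    all rows and columns of [c] sum to [n], [M] is the sum over [a] of
    [n ^ 2 - sum_b (c a b) ^ 2], and [m] is the sum of the defects
    [e a = n - c a a].  Bounding the off-diagonal squares of each row by the
    square of their sum gives [M >= sum_a 2 (e a) (n - e a)], which is at least
    [2 (n m - m ^ 2)].  Minimality under transpositions gives
    [M >= sum_a (e a) ^ 2].  Twice the second bound plus the first is
    [3 M >= 2 n m], more than the [M >= 4 m n / 9] needed for large [m].

    There are at most [binomial (n K) m * K ^ m] assignments at distance [m],
    and the union bound concludes.  For [I >= c log n / n] with [c > 1], the
    [m]-th term of the bound is at most [r ^ m] with [r = O(n ^ (- eta))] for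
    some [eta > 0], so the whole bound is at most [2 r] for large [n]. *)

(** * Disagreements between two balanced labellings *)

Section Contingency.
Variables (T : finType) (c : T -> T -> int) (n : int).
Hypothesis c_ge0 : forall a b, 0 <= c a b.
Hypothesis c_row : forall a, \sum_b c a b = n.
Hypothesis c_col : forall b, \sum_a c a b = n.

(** Row [a] contributes the number of ordered pairs inside class [a] of the first labelling that the
    second one separates. *)
Let excess := \sum_a (n ^+ 2 - \sum_b c a b ^+ 2).

Lemma sumr_sqr_le {I : finType} (Q : pred I) (x : I -> int) :
  (forall i, Q i -> 0 <= x i) ->
  \sum_(i | Q i) x i ^+ 2 <= (\sum_(i | Q i) x i) ^+ 2.
Proof.
move=> x0; rewrite expr2 mulr_suml; apply: ler_sum => i Qi.
rewrite expr2 ler_wpM2l ?x0// (bigD1 i)//= lerDl.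
by apply: sumr_ge0 => j /andP[/x0].
Qed.

Lemma excess_ge_diag : \sum_a 2 * (n - c a a) * c a a <= excess.
Proof.
apply: ler_sum => a _; rewrite (bigD1 a)//=.
have := @sumr_sqr_le _ (fun b => b != a) (c a) (fun b _ => c_ge0 a b).
have -> : \sum_(b | b != a) c a b = n - c a a.
  by rewrite -(c_row a) [in RHS](bigD1 a)//= addrC addrK.
have -> : 2 * (n - c a a) * c a a = n ^+ 2 - (c a a ^+ 2 + (n - c a a) ^+ 2) by ring.
by move=> /= h; rewrite lerD2l lerN2 lerD2l.
Qed.

(* Optimality under transpositions, averaged over pairs [(a, b)] with weights
   [c a b + c b a]. *)
Lemma excess_ge_sqr :
  (forall a b, c a b + c b a <= c a a + c b b) ->
  \sum_a (n - c a a) ^+ 2 <= excess.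
Proof.
move=> opt.
have h : 0 <= \sum_a \sum_b (c a b + c b a) * (c a a + c b b - (c a b + c b a)).
  by apply: sumr_ge0 => a _; apply: sumr_ge0 => b _; apply: mulr_ge0;
    [exact: addr_ge0|rewrite subr_ge0].
(* Expanding [h] leaves the sum of [c a b * c b a]; its terms with [b = a] are the diagonal squares
   that appear in the goal. *)
have hd : \sum_a c a a ^+ 2 <= \sum_a \sum_b c a b * c b a.
  apply: ler_sum => a _; rewrite (bigD1 a)//= -expr2 lerDl.
  by apply: sumr_ge0 => b _; rewrite mulr_ge0.
have S1 : \sum_a \sum_b c a b * c a a = n * \sum_a c a a.
  by rewrite mulr_sumr; apply: eq_bigr => a _; rewrite -mulr_suml c_row.
have S2 : \sum_a \sum_b c b a * c a a = n * \sum_a c a a.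
  by rewrite mulr_sumr; apply: eq_bigr => a _; rewrite -mulr_suml c_col.
have S3 : \sum_a \sum_b c a b * c b b = n * \sum_a c a a.
  by rewrite exchange_big/=; exact: S2.
have S4 : \sum_a \sum_b c b a * c b b = n * \sum_a c a a.
  by rewrite exchange_big/=; exact: S1.
have S5 : \sum_a \sum_b c b a ^+ 2 = \sum_a \sum_b c a b ^+ 2.
  by rewrite exchange_big.
have E : \sum_a \sum_b (c a b + c b a) * (c a a + c b b - (c a b + c b a)) =
    4 * (n * \sum_a c a a) - 2 * (\sum_a \sum_b c a b ^+ 2)
    - 2 * \sum_a \sum_b c a b * c b a.
  pose s (F : T -> T -> int) := \sum_a \sum_b F a b.
  transitivity (s (fun a b => c a b * c a a) + s (fun a b => c b a * c a a) +
      s (fun a b => c a b * c b b) + s (fun a b => c b a * c b b) -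
      s (fun a b => c a b ^+ 2) - s (fun a b => c b a ^+ 2) -
      s (fun a b => c a b * c b a) - s (fun a b => c a b * c b a)).
    rewrite /s -!sumrN -!big_split/=; apply: eq_bigr => a _.
    by rewrite -!sumrN -!big_split/=; apply: eq_bigr => b _; ring.
  by rewrite /s S1 S2 S3 S4 S5; ring.
have F : \sum_a (n - c a a) ^+ 2 =
    \sum_(a : T) n ^+ 2 - 2 * (n * \sum_a c a a) + \sum_a c a a ^+ 2.
  rewrite !mulr_sumr -sumrN -!big_split/=; apply: eq_bigr => a _; ring.
rewrite F /excess sumrB; move: h hd; rewrite E.
move: (n * _) (\sum_a \sum_b c a b ^+ 2) (\sum_a \sum_b c a b * c b a).
move: (\sum_a c a a ^+ 2) (\sum_(a : T) n ^+ 2); lia.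
Qed.

Lemma excess_ge_third :
  (forall a b, c a b + c b a <= c a a + c b b) ->
  2 * n * \sum_a (n - c a a) <= 3 * excess.
Proof.
move=> opt.
(* Termwise, a defect [e = n - c a a] satisfies [2 n e = 2 e ^ 2 + 2 e (n - e)]. *)
have -> : 2 * n * \sum_a (n - c a a) = 2 * (\sum_a (n - c a a) ^+ 2) +
    \sum_a 2 * (n - c a a) * c a a.
  by rewrite !mulr_sumr -big_split/=; apply: eq_bigr => a _; ring.
by have := excess_ge_sqr opt; have := excess_ge_diag; lia.
Qed.

Lemma excess_ge_quad : (forall a, c a a <= n) ->
  2 * n * \sum_a (n - c a a) - 2 * (\sum_a (n - c a a)) ^+ 2 <= excess.
Proof.
move=> cn; apply: le_trans excess_ge_diag.
have h : \sum_a (n - c a a) ^+ 2 <= (\sum_a (n - c a a)) ^+ 2.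
  by apply: sumr_sqr_le => a _; rewrite subr_ge0.

have -> : \sum_a 2 * (n - c a a) * c a a = 2 * n * \sum_a (n - c a a)
    - 2 * \sum_a (n - c a a) ^+ 2.
  by rewrite !mulr_sumr -sumrN -big_split/=; apply: eq_bigr => a _; ring.
lia.
Qed.

End Contingency.

(** These are the edges to which the two labellings assign different densities. The order condition
    counts each unordered pair once. *)
Definition mismatched {N : nat} {T : eqType} (s t : 'I_N -> T) :=
  [set e : 'I_N * 'I_N | (e.1 < e.2)%N && ((s e.1 == s e.2) != (t e.1 == t e.2))].

Definition hamming {V : finType} {T : eqType} (s t : V -> T) : nat :=
  #|[set i | s i != t i]|.

(** * The contingency table of two labellings *)

Section Mismatch.
Variables (N n : nat) (T : finType) (s t : 'I_N -> T).
Hypothesis s_bal : forall k, #|[set i | s i == k]| = n.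
Hypothesis t_bal : forall k, #|[set i | t i == k]| = n.
Hypothesis st_opt : forall f : {perm T}, (hamming s t <= hamming s (f \o t))%N.

(** Sums of products of indicators allow label sums to be exchanged with vertex sums and evaluated
    by [sum_delta]. *)
Let c a b : int := \sum_i (s i == a)%:R * (t i == b)%:R.

Lemma sum_delta (x y : T) : \sum_a (x == a)%:R * (y == a)%:R = (x == y)%:R :> int.
Proof.
rewrite (bigD1 x)//= eqxx mul1r big1 ?addr0 1?eq_sym// => a /negbTE.
by rewrite eq_sym => ->; rewrite mul0r.
Qed.

Lemma sum_eqT (x : T) : \sum_a (x == a)%:R = 1 :> int.
Proof. by rewrite (bigD1 x)//= eqxx big1 ?addr0// => a /negbTE; rewrite eq_sym => ->. Qed.

Lemma sum_fiber (r : 'I_N -> T) : (forall k, #|[set i | r i == k]| = n) ->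
  forall k, \sum_i (r i == k)%:R = n%:R :> int.
Proof.
move=> r_bal k; rewrite -(r_bal k) -sum1dep_card natr_sum [RHS]big_mkcond/=.
by apply: eq_bigr => i _; case: (r i == k).
Qed.

Lemma contingency_row a : \sum_b c a b = n%:R.
Proof.
rewrite /c exchange_big/= -(sum_fiber s s_bal a); apply: eq_bigr => i _.
by rewrite -mulr_sumr sum_eqT mulr1.
Qed.

Lemma contingency_col b : \sum_a c a b = n%:R.
Proof.
rewrite /c exchange_big/= -(sum_fiber t t_bal b); apply: eq_bigr => i _.
by rewrite -mulr_suml sum_eqT mul1r.
Qed.

Lemma contingency_ge0 a b : 0 <= c a b.
Proof. by apply: sumr_ge0 => i _; rewrite mulr_ge0. Qed.

(** Both sides count the ordered pairs of vertices, equal ones included, that share a label. *)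
Lemma sum_sqr_fiber (r : 'I_N -> T) : (forall k, #|[set i | r i == k]| = n) ->
  \sum_(k : T) n%:R ^+ 2 = \sum_i \sum_j (r i == r j)%:R :> int.
Proof.
move=> r_bal.
transitivity (\sum_k \sum_i \sum_j (r i == k)%:R * (r j == k)%:R : int).
  apply: eq_bigr => k _; rewrite -(sum_fiber r r_bal k) expr2 mulr_suml.
  by apply: eq_bigr => i _; rewrite mulr_sumr.
rewrite exchange_big/=; apply: eq_bigr => i _; rewrite exchange_big/=.
by apply: eq_bigr => j _; exact: sum_delta.
Qed.

Lemma sum_sqr_c :
  \sum_a \sum_b c a b ^+ 2 = \sum_i \sum_j ((s i == s j) && (t i == t j))%:R.
Proof.
transitivity (\sum_a \sum_b \sum_i \sum_j
   ((s i == a)%:R * (s j == a)%:R * ((t i == b)%:R * (t j == b)%:R)) : int).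
  apply: eq_bigr => a _; apply: eq_bigr => b _; rewrite expr2 mulr_suml.
  by apply: eq_bigr => i _; rewrite mulr_sumr; apply: eq_bigr => j _; rewrite mulrACA.
under eq_bigr do rewrite exchange_big/=.
rewrite exchange_big/=; apply: eq_bigr => i _.
under eq_bigr do rewrite exchange_big/=.
rewrite exchange_big/=; apply: eq_bigr => j _.
under eq_bigr do rewrite -mulr_sumr sum_delta.
by rewrite -mulr_suml sum_delta -natrM mulnb.
Qed.

Lemma sum_mismatch :
  \sum_i \sum_j ((s i == s j) != (t i == t j))%:R = 2 * #|mismatched s t|%:R :> int.
Proof.
pose g i j : int := ((s i == s j) != (t i == t j))%:R.
have gC i j : g i j = g j i by rewrite /g [s i == _]eq_sym [t i == _]eq_sym.
pose L : int := \sum_(i < N) \sum_(j < N | (i < j)%N) g i j.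
have LE : L = #|mismatched s t|%:R.
  rewrite /L pair_big_dep/= -sum1dep_card natr_sum big_mkcondr/=.
  apply: eq_bigr => -[i j] _ /=; by rewrite /g; case: (_ != _).
rewrite -LE mulr2n mulrDl mul1r.
rewrite {2}/L [X in _ = _ + X](exchange_big_dep xpredT)//=.
rewrite -big_split/=; apply: eq_bigr => i _.
rewrite (bigID (fun j : 'I_N => (i < j)%N))/=; congr (_ + _).
(* The diagonal terms vanish, so each unordered pair is counted exactly twice. *)
rewrite [LHS](bigID (fun j : 'I_N => j == i))/= [X in X + _]big1 ?add0r; last first.
  by move=> j /andP[_ /eqP->]; rewrite !eqxx.
apply: eq_big => [j|j _]; last exact: gC.
by rewrite -leqNgt ltn_neqAle andbC.
Qed.

(** The left side counts ordered pairs together in [s] but not in [t]. By balance, equally many are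
    together in [t] but not in [s], and the two kinds make up twice the number of mismatched
    edges. *)
Lemma excess_eq : \sum_a (n%:R ^+ 2 - \sum_b c a b ^+ 2) = #|mismatched s t|%:R.
Proof.
apply: (@mulfI _ 2) => //; rewrite -sum_mismatch sumrB sum_sqr_c.
rewrite mulrBr mulr2n !mulrDl !mul1r {1}(sum_sqr_fiber s s_bal) (sum_sqr_fiber t t_bal).
rewrite -!big_split/= -sumrN -big_split/=; apply: eq_bigr => i _.
rewrite -!big_split/= -sumrN -big_split/=; apply: eq_bigr => j _.
by case: (s i == s j); case: (t i == t j).
Qed.

Lemma sum_diag (r : 'I_N -> T) :
  \sum_i (s i == r i)%:R = N%:R - (hamming s r)%:R :> int.
Proof.
apply/eqP; rewrite eq_sym subr_eq /hamming -sum1dep_card natr_sum.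
rewrite [X in _ + X]big_mkcond/=.
rewrite -big_split/= -[X in X%:R == _]card_ord -sum1_card natr_sum; apply/eqP.
by apply: eq_bigr => i _; case: (s i == r i).
Qed.

Lemma sum_excess_diag : \sum_a (n%:R - c a a) = (hamming s t)%:R.
Proof.
rewrite sumrB; under eq_bigr => a _ do rewrite -(sum_fiber s s_bal a).
rewrite exchange_big/=; under eq_bigr do rewrite sum_eqT.
rewrite {1}/c exchange_big/=; under [X in _ - X]eq_bigr do rewrite sum_delta.
by rewrite sum_diag sumr_const card_ord; lia.
Qed.

(** This is the loss of agreement at one vertex, with labels [x] and [y], when [a] and [b] are
    swapped in the second labelling. Summed over vertices it gives [c a a + c b b - c a b - c b a],
    which minimality makes nonnegative. *)
Lemma tperm_delta (a b x y : T) : a != b ->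
  (x == y)%:R - (x == tperm a b y)%:R =
  (x == a)%:R * (y == a)%:R + (x == b)%:R * (y == b)%:R
  - (x == a)%:R * (y == b)%:R - (x == b)%:R * (y == a)%:R :> int.
Proof.
move=> ab; have ba : b != a by rewrite eq_sym.
case: tpermP => [->|->|/eqP/negbTE-> /eqP/negbTE->]; last by rewrite !mulr0 !subrr.
  by rewrite eqxx (negbTE ab) !mulr1 !mulr0 subr0 addr0.
by rewrite eqxx (negbTE ba) !mulr1 !mulr0 subr0 add0r.
Qed.

Lemma contingency_opt a b : c a b + c b a <= c a a + c b b.
Proof.
have [->//|ab] := eqVneq a b.
have := st_opt (tperm a b); rewrite -(ler_nat int) -subr_ge0.
have -> : (hamming s (tperm a b \o t))%:R - (hamming s t)%:R =
    \sum_i (s i == t i)%:R - \sum_i (s i == tperm a b (t i))%:R :> int.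
  by rewrite !sum_diag [hamming s (tperm a b \o t)]/(hamming _ _); lia.
rewrite -sumrB; under eq_bigr do rewrite tperm_delta//.
rewrite !sumrB !big_split/= => h.
by rewrite -subr_ge0 opprD addrA.
Qed.

Lemma mismatched_ge_quad :
  (2 * (n * hamming s t) <= #|mismatched s t| + 2 * hamming s t ^ 2)%N.
Proof.
have cn a : c a a <= n%:R.
  rewrite -(contingency_row a) (bigD1 a)//= lerDl.
  by apply: sumr_ge0 => *; exact: contingency_ge0.
have := excess_ge_quad _ _ _ contingency_ge0 contingency_row cn.
by rewrite excess_eq sum_excess_diag; lia.
Qed.

Lemma mismatched_ge_third : (2 * (n * hamming s t) <= 3 * #|mismatched s t|)%N.
Proof.
have := excess_ge_third _ _ _ contingency_ge0 contingency_row contingency_col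
  contingency_opt.
by rewrite excess_eq sum_excess_diag; lia.
Qed.

End Mismatch.

(** * Optimal relabelling and the size of Hamming spheres *)

Lemma optimal_relabeling {V T : finType} (s t : V -> T) :
  exists f : {perm T}, forall g : {perm T},
    (hamming s (f \o t) <= hamming s (g \o (f \o t)))%N.
Proof.
case: (@arg_minnP _ 1%g xpredT (fun f : {perm T} => hamming s (f \o t))) => // f _ fmin.
(* Permutations multiply from left to right, so [f * g] acts as [g \o f]. *)
exists f => g; apply: leq_trans (fmin (f * g)%g isT) _.
by apply: subset_leq_card; apply/fintype.subsetP => i; rewrite !inE /= permM.
Qed.

(** Labellings are grouped by the set [D] where they differ from [s]: there are ['C(#|V|, m)] such
    sets, at most [#|T|] labels at each point of [D], and a forced label elsewhere. *)
Lemma card_hamming_sphere {V T : finType} (s : V -> T) (m : nat) :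
  (#|[set t : {ffun V -> T} | hamming s t == m]| <= 'C(#|V|, m) * #|T| ^ m)%N.
Proof.
rewrite -sum1dep_card.
rewrite (partition_big (fun t : {ffun V -> T} => [set i | s i != t i])
  (fun D : {set V} => #|D| == m))//=.
rewrite -card_draws -sum_nat_const.
rewrite [leqRHS](eq_bigl (fun D : {set V} => #|D| == m)); last first.
  by move=> D; rewrite inE.
apply: leq_sum => D /eqP <-.
pose F i := if i \in D then predT else pred1 (s i).
have -> : (#|T| ^ #|D| = #|(family F : {pred {ffun V -> T}})|)%N.
  rewrite card_family foldrE big_map big_enum/= -prod_nat_const big_mkcond/=.
  by apply: eq_bigr => i _; rewrite /F; case: ifP => _; rewrite ?card1 ?cardT.
rewrite sum1_card; apply: subset_leq_card; apply/fintype.subsetP => t.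
rewrite unfold_in/= => /andP[_ /eqP DE]; apply/familyP => i; rewrite /F -DE inE.
by case: (eqVneq (s i) (t i)) => //= ->; rewrite inE.
Qed.

(** Induction on [m] through [(1 + 1 / m) ^ m <= e]. *)
Lemma pow_self_le_fact {R : realType} (m : nat) :
  m%:R ^+ m <= expR 1 ^+ m * (m`!)%:R :> R.
Proof.
elim: m => [|m IH]; first by rewrite !expr0 mul1r fact0.
have step : m.+1%:R ^+ m <= expR 1 * m%:R ^+ m :> R.
  case: m {IH} => [|m]; first by rewrite !expr0 mulr1 -[leLHS]expR0 ler_expR.
  have m0 : 0 < m.+1%:R :> R by rewrite ltr0n.
  have -> : m.+2%:R = (1 + m.+1%:R^-1) * m.+1%:R :> R.
    by rewrite [RHS]mulrDl mul1r mulVf ?gt_eqF// natr1.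
  rewrite exprMn ler_wpM2r ?exprn_ge0//.
  apply: (@le_trans _ _ (expR (m.+1%:R^-1) ^+ m.+1)).
    by apply: lerXn2r; rewrite ?nnegrE ?expR_ge0 ?expR_ge1Dx ?addr_ge0 ?invr_ge0.
  by rewrite -expRM_natl mulfV ?gt_eqF.
rewrite exprS factS natrM [expR 1 ^+ _]exprS.
rewrite [leRHS](_ : _ = m.+1%:R * (expR 1 * (expR 1 ^+ m * m`!%:R))); last by ring.
by rewrite ler_wpM2l// (le_trans step)// ler_wpM2l ?expR_ge0.
Qed.

(** The falling factorial is at most [N ^ m], and [1 / m!] is at most [(e / m) ^ m]. *)
Lemma bin_le_pow {R : realType} (N m : nat) : (0 < m)%N ->
  'C(N, m)%:R <= (expR 1 * N%:R / m%:R) ^+ m :> R.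
Proof.
move=> m0; have m0' : 0 < m%:R :> R by rewrite ltr0n.
have f0 : 0 < m`!%:R :> R by rewrite ltr0n fact_gt0.
rewrite !exprMn exprVn ler_pdivlMr ?exprn_gt0//.
apply: (@le_trans _ _ ('C(N, m)%:R * (expR 1 ^+ m * m`!%:R))).
  by rewrite ler_wpM2l// pow_self_le_fact.
rewrite mulrCA ler_wpM2l ?exprn_ge0 ?expR_ge0// -natrM bin_ffact -natrX ler_nat.
rewrite ffact_prod -[X in (_ <= _ ^ X)%N](card_ord m) -prod_nat_const.
apply: (big_ind2 (fun a b => a <= b)%N) => [|a b a' b' ab ab'|i _] //.
  exact: leq_mul.
exact: leq_subr.
Qed.

(** The first bound is [bin_le_pow] for [n * K] vertices times [K ^ m] choices of labels; the second
    counts all labellings. *)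
Lemma card_hamming_sphere_le {R : realType} (n K m : nat) (s : 'I_(n * K) -> 'I_K) :
  (0 < m)%N ->
  #|[set t : {ffun 'I_(n * K) -> 'I_K} | hamming s t == m]|%:R <=
  Num.min ((expR 1 * n%:R * K%:R ^+ 2 / m%:R) ^+ m) (K%:R ^+ (n * K)) :> R.
Proof.
move=> m0; rewrite le_min; apply/andP; split; last first.
  rewrite -natrX ler_nat (leq_trans (max_card _))//.
  by rewrite card_ffun !card_ord.
apply: (@le_trans _ _ ('C(n * K, m) * K ^ m)%:R).
  by rewrite ler_nat (leq_trans (card_hamming_sphere _ _))// !card_ord.
rewrite natrM natrX (le_trans (ler_wpM2r _ (bin_le_pow _ _ m0)))//.
rewrite -exprMn natrM le_eqVlt; apply/orP; left; apply/eqP; congr (_ ^+ _).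
by ring.
Qed.

Local Open Scope classical_set_scope.

(** * Expectations of independent variables *)

Lemma measurable_fun_bigprod {R : realType} {d : measure_display}
    {T : measurableType d} {I : Type} (s : seq I) (Q : pred I) (h : I -> T -> R) :
  (forall i, Q i -> measurable_fun setT (h i)) ->
  measurable_fun setT (fun x => \prod_(i <- s | Q i) h i x).
Proof.
move=> mh; elim: s => [|i s IH].
  by under eq_fun do rewrite big_nil; exact: measurable_cst.
under eq_fun do rewrite big_cons.
by have [/mh mhi|//] := boolP (Q i); exact: measurable_funM.
Qed.

Section Transfer.
Import HBNNSimple.
Context {R : realType} {dX : measure_display} {X : measurableType dX}.
Local Open Scope ereal_scope.

Lemma ge0_integral_nnsfun_compM {d : measure_display} {T : measurableType d}
    (m : {measure set T -> \bar R}) (Y : T -> X) (g : T -> R)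
    (h : {nnsfun X >-> R}) :
  measurable_fun setT Y -> measurable_fun setT g -> (forall t, (0 <= g t)%R) ->
  \int[m]_t ((h (Y t))%:E * (g t)%:E) =
  \sum_(k \in range h)
    k%:E * \int[m]_t ((\1_(h @^-1` [set k]) (Y t))%:E * (g t)%:E).
Proof.
move=> mY mg g0.
have mgE : measurable_fun setT (EFin \o g) by exact/measurable_EFinP.
have mI k : measurable_fun setT (fun t => (\1_(h @^-1` [set k]) (Y t))%:E : \bar R).
  by apply/measurable_EFinP; apply: measurableT_comp => //.
transitivity (\int[m]_t (\sum_(k \in range h)
    (k * \1_(h @^-1` [set k]) (Y t))%:E * (g t)%:E)).
  apply: eq_integral => t _; rewrite -ge0_mule_fsuml; last first.
    by move=> y; exact: nnfun_muleindic_ge0.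
  by rewrite fsumEFin // -fimfunE.
rewrite ge0_integral_fsum//; last 2 first.
- move=> k; apply: emeasurable_funM => //.
  by under eq_fun do rewrite EFinM; apply: emeasurable_funM.
- by move=> k t _; rewrite mule_ge0 ?EFinM ?nnfun_muleindic_ge0 ?lee_fin.
apply: eq_fsbigr => k /[1!inE] -[x _ <-].
under eq_integral do rewrite EFinM -muleA.
rewrite ge0_integralZl//.
- exact: emeasurable_funM.
- by move=> t _; rewrite mule_ge0// lee_fin.
- by rewrite lee_fin.
Qed.

Lemma integral_nnsfun_approx {d : measure_display} {T : measurableType d}
    (m : {measure set T -> \bar R}) (Y : T -> X) (g : T -> R) (f : X -> R)
    (mf : measurable_fun setT (EFin \o f)) :
  measurable_fun setT Y -> measurable_fun setT g -> (forall t, (0 <= g t)%R) ->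
  (forall x, (0 <= f x)%R) ->
  \int[m]_t ((f (Y t))%:E * (g t)%:E) =
  limn (fun n => \int[m]_t ((nnsfun_approx measurableT mf n (Y t))%:E * (g t)%:E)).
Proof.
move=> mY mg g0 f0; rewrite -monotone_convergence//.
- apply: eq_integral => t _; apply/esym/cvg_lim => //.
  apply: cvgeZr => //.
  have := @cvg_nnsfun_approx _ _ _ _ measurableT _ mf.
  by apply => // x _; rewrite lee_fin.
- move=> n; apply: emeasurable_funM; last exact/measurable_EFinP.
  by apply/measurable_EFinP; apply: measurableT_comp.
- by move=> n t _; rewrite mule_ge0// lee_fin.
- move=> t _ a b ab; rewrite lee_wpmul2r ?lee_fin//.
  exact/lefP/nd_nnsfun_approx.
Qed.

(** Extension from indicators to nonnegative functions by simple functions and monotone convergence.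
    With [g1] the other factors of a product and [g2] a constant, it splits off one independent
    factor; with [Y2] the identity and [g2] a density, it integrates against a law. *)
Lemma ge0_integral_transfer {d1 d2 : measure_display}
    {T1 : measurableType d1} {T2 : measurableType d2}
    (m1 : {measure set T1 -> \bar R}) (m2 : {measure set T2 -> \bar R})
    (Y1 : T1 -> X) (Y2 : T2 -> X) (g1 : T1 -> R) (g2 : T2 -> R) (f : X -> R) :
  measurable_fun setT Y1 -> measurable_fun setT Y2 ->
  measurable_fun setT g1 -> measurable_fun setT g2 ->
  (forall t, 0 <= g1 t)%R -> (forall t, 0 <= g2 t)%R ->
  (forall A, measurable A ->
    \int[m1]_t ((\1_A (Y1 t))%:E * (g1 t)%:E) =
    \int[m2]_t ((\1_A (Y2 t))%:E * (g2 t)%:E)) ->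
  measurable_fun setT f -> (forall x, 0 <= f x)%R ->
  \int[m1]_t ((f (Y1 t))%:E * (g1 t)%:E) = \int[m2]_t ((f (Y2 t))%:E * (g2 t)%:E).
Proof.
move=> mY1 mY2 mg1 mg2 g10 g20 H /measurable_EFinP mf f0.
rewrite !(integral_nnsfun_approx _ _ _ _ mf)//; congr (limn _); apply/funext => n.
rewrite !ge0_integral_nnsfun_compM//.
by apply: eq_fsbigr => k _; rewrite H.
Qed.

End Transfer.

Section Independence.
Context {R : realType} {dX : measure_display} {X : measurableType dX}.
Context {d : measure_display} {Omega : measurableType d}.
Variables (P : probability Omega R) (I : finType) (J : {set I}).
Variable Y : I -> Omega -> X.
Hypothesis mY : forall e, e \in J -> measurable_fun setT (Y e).
Hypothesis indep : forall A : I -> set X, (forall e, measurable (A e)) ->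
  P (\bigcap_(e in [set` J]) (Y e @^-1` A e)) =
  (\prod_(e in J) P (Y e @^-1` A e))%E.
Local Open Scope ereal_scope.

Lemma prod_indic (A : I -> set X) (w : Omega) :
  (\prod_(e in J) (\1_(A e) (Y e w) : R) =
  \1_(\bigcap_(e in [set` J]) (Y e @^-1` A e)) w)%R.
Proof.
rewrite [RHS]indicE; case: (boolP (w \in _)) => [/set_mem h|/negP h].
  by rewrite big1// => e eJ; rewrite indicE mem_set//; exact: h.
have [e eJ eA] : exists2 e, e \in J & ~ A e (Y e w).
  apply: contrapT => h'; apply: h; apply/mem_set => e /= eJ.
  by apply: contrapT => h''; apply: h'; exists e.
by rewrite (bigD1 e)//= indicE memNset// mul0r.
Qed.

(** Factors outside [S] are indicators, and the induction is on [S]. The base case is independence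
    of events; in the step, the transfer lemma reduces the factor at [a] to an indicator, which the
    induction hypothesis covers. *)
Lemma expectation_prod_indep_seq (S : seq I) (f : I -> X -> R) (c : I -> R) :
  (forall e, e \in J -> measurable_fun setT (f e)) ->
  (forall e x, 0 <= f e x)%R ->
  (forall e, e \in J -> e \notin S -> exists2 A, measurable A & f e = \1_A) ->
  (forall e, e \in J -> \int[P]_w (f e (Y e w))%:E = (c e)%:E) ->
  \int[P]_w (\prod_(e in J) f e (Y e w))%:E = (\prod_(e in J) c e)%:E.
Proof.
elim: S f c => [|a S IH] f c mf f0 fS fc.
  have /choice[A hA] : forall e, exists A, measurable A /\ (e \in J -> f e = \1_A).
    move=> e; have [eJ|_] := boolP (e \in J); last by exists setT.
    by have [//|A mA ->] := fS _ eJ; exists A.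
  have mA e : measurable (A e) by case: (hA e).
  have mYA e : e \in J -> measurable (Y e @^-1` A e).
    by move=> eJ; rewrite -[X in measurable X]setTI; exact: mY.
  transitivity (P (\bigcap_(e in [set` J]) (Y e @^-1` A e))).
    under eq_integral => w _.
      under eq_bigr => e eJ do rewrite (proj2 (hA e) eJ).
      rewrite prod_indic; over.
    rewrite integral_indic ?setIT//.
    by apply: fin_bigcap_measurable => // e; exact: mYA.
  rewrite indep// (big_morph EFin (id1 := 1%E) (op1 := mule) EFinM)//.
  apply: eq_bigr => e eJ; rewrite -fc// (proj2 (hA e) eJ).
  rewrite [RHS](_ : _ = \int[P]_w (\1_(Y e @^-1` A e) w)%:E)//.
  by rewrite integral_indic ?setIT//; exact: mYA.
have [aJ|aJ] := boolP (a \in J); last first.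
  apply: IH => // e eJ eS; apply: fS => //; rewrite inE negb_or eS andbT.
  by apply: contraNneq aJ => <-.
(* [G] collects the other factors and [C] is its expected value; the factor at [a] will be
   integrated against each of them. *)
pose G w := (\prod_(e in J | e != a) f e (Y e w))%R.
pose C := (\prod_(e in J | e != a) c e)%R.
have c0 e : e \in J -> (0 <= c e)%R.
  by move=> eJ; rewrite -lee_fin -fc//; apply: integral_ge0 => w _; rewrite lee_fin.
have C0 : (0 <= C)%R by apply: prodr_ge0 => e /andP[/c0].
have mG : measurable_fun setT G.
  apply: measurable_fun_bigprod => e /andP[eJ _].
  by apply: measurableT_comp; [exact: mf|exact: mY].
under eq_integral do rewrite (bigD1 a)//= EFinM.
rewrite (bigD1 a)//= -/C.
rewrite (@ge0_integral_transfer _ _ _ _ _ _ _ P P (Y a) (Y a) G (cst C))//; first last.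
- exact: mf.
- move=> A mA.
  have mYA : measurable (Y a @^-1` A) by rewrite -[X in measurable X]setTI; exact: mY.
  have iYA : \int[P]_w (\1_A (Y a w))%:E = P (Y a @^-1` A).
    by rewrite [LHS](_ : _ = \int[P]_w (\1_(Y a @^-1` A) w)%:E)// integral_indic ?setIT.
  rewrite /= ge0_integralZr//; last first.
    by apply/measurable_EFinP; apply: measurableT_comp; [|exact: mY].
  rewrite iYA.
  (* The factor at [a] is replaced by the indicator of [A], and its expectation by the matching
     probability. *)
  pose f' e := if e == a then \1_A else f e.
  pose c' e := if e == a then fine (P (Y a @^-1` A)) else c e.
  have := IH f' c'; rewrite (bigD1 a)//= /c' eqxx => IH'.
  rewrite -[P _]fineK ?fin_num_measure// -EFinM.
  rewrite -[in RHS]/C.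
  have -> : C = (\prod_(i in J | i != a)
      (if i == a then fine (P (Y a @^-1` A)) else c i))%R.
    by apply: eq_bigr => e /andP[_ /negbTE->].
  rewrite -IH'//.
  + apply: eq_integral => w _; rewrite (bigD1 a)//= /f' eqxx EFinM; congr (_ * _%:E).
    by apply: eq_bigr => e /andP[_ /negbTE->].
  + by move=> e eJ; rewrite /f'; case: ifP => // _; exact: mf.
  + by move=> e x; rewrite /f'; case: ifP => // _; exact: f0.
  + move=> e eJ eS; rewrite /f'; case: eqP => [_|/eqP ea]; first by exists A.
    by apply: fS => //; rewrite inE negb_or ea.
  + move=> e eJ; rewrite /f'; case: eqP => [->|_]; last exact: fc.
    by rewrite iYA fineK// fin_num_measure.
- by move=> w; apply: prodr_ge0 => e _; exact: f0.
- exact: mY.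
- exact: mY.
rewrite /= ge0_integralZr ?fc//.
  by apply/measurable_EFinP; apply: measurableT_comp; [exact: mf|exact: mY].
by move=> w _; rewrite lee_fin.
Qed.

Lemma expectation_prod_indep (f : I -> X -> R) (c : I -> R) :
  (forall e, e \in J -> measurable_fun setT (f e)) ->
  (forall e x, 0 <= f e x)%R ->
  (forall e, e \in J -> \int[P]_w (f e (Y e w))%:E = (c e)%:E) ->
  \int[P]_w (\prod_(e in J) f e (Y e w))%:E = (\prod_(e in J) c e)%:E.
Proof.
move=> mf f0 fc; apply: (@expectation_prod_indep_seq (enum I)) => // e _.
by rewrite mem_enum.
Qed.

End Independence.

(** * Chernoff bound for one competitor *)

Lemma measurable_sqrtr {R : realType} : measurable_fun setT (@Num.sqrt R : R -> R).
Proof. by apply: continuous_measurable_fun; exact: sqrt_continuous. Qed.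

Section Densities.
Context {R : realType} {dX : measure_display} {X : measurableType dX}.
Variable mu : {measure set X -> \bar R}.

Section Bhattacharyya.
Variables (p q : X -> R).
Hypotheses (dp : is_density mu p) (dq : is_density mu q).

Lemma measurable_sqrt_density :
  measurable_fun setT (fun x => Num.sqrt (p x * q x)).
Proof.
case: dp dq => mp _ _ [mq _ _].
by apply: (measurableT_comp measurable_sqrtr); exact: measurable_funM.
Qed.

(** The arithmetic-geometric mean inequality bounds the integrand by [(p + q) / 2]. The integral is
    thus finite, and [fine] in [bhattacharyya] does not change its value. *)
Lemma integral_sqrt_le1 : (\int[mu]_x (Num.sqrt (p x * q x))%:E <= 1)%E.
Proof.
have msqrt := measurable_sqrt_density.
case: dp dq => mp p0 ip [mq q0 iq].
apply: (@le_trans _ _ (\int[mu]_x ((2^-1)%:E * ((p x)%:E + (q x)%:E)))%E).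
  apply: ge0_le_integral => //.
  - exact/measurable_EFinP.
  - apply: emeasurable_funM => //; apply: emeasurable_funD; exact/measurable_EFinP.
  - move=> x _; rewrite -EFinD -EFinM lee_fin.
    rewrite sqrtrM// -[X in _ * (X + _)]sqr_sqrtr// -[X in _ * (_ + X)]sqr_sqrtr//.
    have := sqr_ge0 (Num.sqrt (p x) - Num.sqrt (q x)); nra.
rewrite ge0_integralZl//.
- rewrite ge0_integralD//.
  + by rewrite ip iq -EFinD -EFinM lee_fin mulVf.
  + by move=> x _; rewrite lee_fin.
  + exact/measurable_EFinP.
  + by move=> x _; rewrite lee_fin.
  + exact/measurable_EFinP.
- apply: emeasurable_funD; exact/measurable_EFinP.
- by move=> x _; rewrite adde_ge0// lee_fin.
Qed.

Lemma integral_sqrtE :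
  (\int[mu]_x (Num.sqrt (p x * q x))%:E = (bhattacharyya mu p q)%:E)%E.
Proof.
rewrite /bhattacharyya fineK// ge0_fin_numE.
  by apply: le_lt_trans integral_sqrt_le1 _; rewrite ltry.
by apply: integral_ge0 => x _; rewrite lee_fin sqrtr_ge0.
Qed.

Lemma bhattacharyya_ge0 : 0 <= bhattacharyya mu p q.
Proof.
rewrite -lee_fin -integral_sqrtE.
by apply: integral_ge0 => x _; rewrite lee_fin sqrtr_ge0.
Qed.

Lemma bhattacharyya_le1 : bhattacharyya mu p q <= 1.
Proof. by rewrite -lee_fin -integral_sqrtE; exact: integral_sqrt_le1. Qed.

(** For [b > 0] this compares [M * ln b] with [2 * a * ln b], where [ln b <= 0]. For [b = 0] the
    divergence is infinite and [0 < M] makes the left side zero. *)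
Lemma exp_bhattacharyya_le (M : nat) (a : R) : (0 < M)%N -> 2 * a <= M%:R ->
  ((bhattacharyya mu p q ^+ M)%:E <= expeR ((- a)%:E * renyi_half mu p q))%E.
Proof.
move=> M0 aM; have [b0|b0] := eqVneq (bhattacharyya mu p q) 0.
  by rewrite b0 expr0n gtn_eqF//= expeR_ge0.
have bp : 0 < bhattacharyya mu p q by rewrite lt_neqAle eq_sym b0 bhattacharyya_ge0.
rewrite /renyi_half (negbTE b0) -EFinM/= lee_fin.
rewrite -[X in X ^+ _ <= _]lnK ?posrE// -expRM_natl ler_expR.
by rewrite mulrA mulrNN [a * 2]mulrC ler_wnM2r// ln_le0// bhattacharyya_le1.
Qed.

End Bhattacharyya.

Context {d : measure_display} {Omega : measurableType d}.
Variable P : probability Omega R.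

Lemma integral_has_density (Y : Omega -> X) (f h : X -> R) :
  has_density mu P Y f -> is_density mu f ->
  measurable_fun setT h -> (forall x, 0 <= h x) ->
  (\int[P]_w (h (Y w))%:E = \int[mu]_x (h x * f x)%:E)%E.
Proof.
move=> [mY PY] [mf f0 _] mh h0.
under [LHS]eq_integral do rewrite -[(_)%:E]mule1.
under [RHS]eq_integral do rewrite EFinM.
apply: (@ge0_integral_transfer _ _ _ _ _ _ _ P mu Y id (cst 1) f) => // A mA.
have mYA : measurable (Y @^-1` A) by rewrite -[X in measurable X]setTI; exact: mY.
rewrite [LHS](_ : _ = \int[P]_w (\1_(Y @^-1` A) w)%:E)%E; last first.
  by apply: eq_integral => w _; rewrite -EFinM mulr1.
transitivity (P (Y @^-1` A)); first by rewrite integral_indic// setIT.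
rewrite PY// integral_mkcond; apply: eq_integral => x _.
by rewrite patchE indicE; case: ifP => _; rewrite ?mul1e ?mul0e.
Qed.

End Densities.

Section PairwiseError.
Context {R : realType} {dX : measure_display} {X : measurableType dX}.
Variable mu : {measure set X -> \bar R}.
Context {d : measure_display} {Omega : measurableType d}.
Variables (P : probability Omega R) (N K : nat).
Variables (W : 'I_N -> 'I_N -> Omega -> X) (p q : X -> R) (s t : 'I_N -> 'I_K).
Hypotheses (dp : is_density mu p) (dq : is_density mu q).
Hypothesis dW : forall i j : 'I_N, (i < j)%N ->
  has_density mu P (W i j) (if s i == s j then p else q).
Hypothesis indW : edges_independent P W.

Let edges : {set 'I_N * 'I_N} := [set e : 'I_N * 'I_N | (e.1 < e.2)%N]%SET.
Let edge_density (r : 'I_N -> 'I_K) (e : 'I_N * 'I_N) :=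
  if r e.1 == r e.2 then p else q.
Let Y (e : 'I_N * 'I_N) := W e.1 e.2.

Lemma likelihood_edges (r : 'I_N -> 'I_K) w :
  likelihood p q r (fun i j => W i j w) = \prod_(e in edges) edge_density r e (Y e w).
Proof.
rewrite /likelihood pair_big_dep/=; apply: eq_big => [e|e _]; first by rewrite inE.
by rewrite /edge_density /Y; case: ifP.
Qed.

Lemma edge_density_is_density r e : is_density mu (edge_density r e).
Proof. by rewrite /edge_density; case: ifP. Qed.

Lemma edge_density_ge0 r e x : 0 <= edge_density r e x.
Proof. by case: (edge_density_is_density r e). Qed.

Lemma measurable_edge_density r e : measurable_fun setT (edge_density r e).
Proof. by case: (edge_density_is_density r e). Qed.

Lemma edge_has_density e : e \in edges -> has_density mu P (Y e) (edge_density s e).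
Proof. by rewrite inE => /dW. Qed.

Lemma measurable_edge e : e \in edges -> measurable_fun setT (Y e).
Proof. by move=> /edge_has_density[]. Qed.

Lemma measurable_likelihood (r : 'I_N -> 'I_K) :
  measurable_fun setT (fun w => likelihood p q r (fun i j => W i j w)).
Proof.
under eq_fun do rewrite likelihood_edges.
apply: measurable_fun_bigprod => e eJ; apply: measurableT_comp (measurable_edge e eJ).
exact: measurable_edge_density.
Qed.

Lemma measurable_likelihood_le :
  measurable [set w | likelihood p q s (fun i j => W i j w)
    <= likelihood p q t (fun i j => W i j w)].
Proof.
have := measurable_fun_ler (measurable_likelihood s) (measurable_likelihood t).
move=> /(_ measurableT [set true] I); rewrite setTI.
by congr measurable; apply/seteqP; split => w /=.
Qed.

(** The Chernoff factor of one edge. Division by zero returns 0, so [vanishing] accounts for the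
    points where the true density is zero. *)
Let ratio e x := Num.sqrt (edge_density t e x / edge_density s e x).
Let vanishing e := [set x | edge_density s e x = 0].

Lemma measurable_ratio e : measurable_fun setT (ratio e).
Proof.
apply: (measurableT_comp measurable_sqrtr); apply: measurable_funM.
  exact: measurable_edge_density.
under eq_fun do rewrite -powR_inv1 ?edge_density_ge0//.
by apply: (measurableT_comp (measurable_powR _)); exact: measurable_edge_density.
Qed.

Lemma measurable_vanishing e : measurable (vanishing e).
Proof.
have := measurable_edge_density s e.
move=> /(_ measurableT [set 0] (measurable_set1 _)); rewrite setTI.
by congr measurable; apply/seteqP; split => w /=.
Qed.

(** Multiplied by the true density, [ratio] becomes the square root of the product of both
    densities, also where the true density is zero. Equal densities give integral 1, different ones
    [b]. *)
Lemma integral_ratio e : e \in edges ->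
  (\int[P]_w (ratio e (Y e w))%:E =
   (if (s e.1 == s e.2) != (t e.1 == t e.2) then bhattacharyya mu p q else 1)%:E)%E.
Proof.
move=> eJ; rewrite (integral_has_density mu P _ _ _ (edge_has_density e eJ)); last first.
- by move=> x; exact: sqrtr_ge0.
- exact: measurable_ratio.
- exact: edge_density_is_density.
transitivity (\int[mu]_x (Num.sqrt (edge_density s e x * edge_density t e x))%:E)%E.
  apply: eq_integral => x _; congr EFin; rewrite /ratio.
  have := edge_density_ge0 s e x; set a := edge_density s e x => a0.
  have [->|an0] := eqVneq a 0; first by rewrite mul0r mulr0 sqrtr0.
  rewrite -{2}(sqr_sqrtr a0) expr2 mulrA -sqrtrM; last first.
    by rewrite divr_ge0// edge_density_ge0.
  by rewrite divfK// mulrC -sqrtrM.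
have [[_ p0 p1] [_ q0 q1]] := (dp, dq).
rewrite /edge_density; case: ifP => _; case: ifP => _ /=.
- under eq_integral do rewrite -expr2 sqrtr_sqr ger0_norm//.
  exact: p1.
- exact: integral_sqrtE.
- under eq_integral do rewrite mulrC.
  exact: integral_sqrtE.
- under eq_integral do rewrite -expr2 sqrtr_sqr ger0_norm//.
  exact: q1.
Qed.

Lemma integral_vanishing e : e \in edges ->
  (\int[P]_w (\1_(vanishing e) (Y e w))%:E = 0)%E.
Proof.
move=> eJ; rewrite (integral_has_density mu P _ _ _ (edge_has_density e eJ)); last first.
- by [].
- exact: measurable_indic (measurable_vanishing e).
- exact: edge_density_is_density.
rewrite integral0_eq// => x _; rewrite indicE.
by case: (boolP (x \in _)) => [/set_mem->|_]; rewrite ?mulr0 ?mul0r.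
Qed.

(* Where the likelihood of [s] is positive, the product of the [ratio]s is the
   square root of the likelihood ratio; elsewhere some true density vanishes. *)
Lemma indic_likelihood_le w :
  \1_[set w | likelihood p q s (fun i j => W i j w)
    <= likelihood p q t (fun i j => W i j w)] w <=
  \prod_(e in edges) ratio e (Y e w)
    + \sum_(e in edges) \1_(vanishing e) (Y e w) :> R.
Proof.
have prod0 : 0 <= \prod_(e in edges) ratio e (Y e w).
  by apply: prodr_ge0 => e _; exact: sqrtr_ge0.
have sum0 (Q : pred ('I_N * 'I_N)) :
    0 <= \sum_(e | Q e) \1_(vanishing e) (Y e w) :> R by apply: sumr_ge0.
rewrite indicE; case: (boolP (w \in _)) => [/set_mem/= le_st|_]; last exact: addr_ge0.
have [/existsP[e /andP[eJ /eqP e0]]|/existsPn nz] :=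
    boolP [exists e, (e \in edges) && (edge_density s e (Y e w) == 0)].
  (* The indicator of this vanishing edge alone already reaches 1. *)
  rewrite [X in _ + X](bigD1 e)//= indicE mem_set// addrCA lerDl.
  by rewrite addr_ge0.
apply: ler_wpDr => //.
have Lpos : 0 < likelihood p q s (fun i j => W i j w).
  rewrite likelihood_edges; apply: prodr_gt0 => e eJ.
  rewrite lt_neqAle edge_density_ge0 andbT eq_sym.
  by have := nz e; rewrite eJ.
rewrite -(@ler_sqr _ 1)// ?nnegrE// expr1n -prodrXl.
under eq_bigr => e _.
  rewrite sqr_sqrtr ?divr_ge0 ?edge_density_ge0//; over.
by rewrite prodf_div -!likelihood_edges ler_pdivlMr// mul1r.
Qed.

(** The pointwise bound is integrated: independence factors the expectation of the product, leaving
    one [b] per mismatched edge, and the vanishing terms integrate to zero. *)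
Lemma pairwise_error :
  (P [set w | (likelihood p q s (fun i j => W i j w)
    <= likelihood p q t (fun i j => W i j w))%R]
  <= (bhattacharyya mu p q ^+ #|mismatched s t|)%:E)%E.
Proof.
have mE := measurable_likelihood_le; set E := [set w | _] in mE *.
have mr e : e \in edges -> measurable_fun setT (fun w => ratio e (Y e w)).
  by move=> eJ; apply: measurableT_comp (measurable_edge e eJ); exact: measurable_ratio.
(* Measurability of [W i j] is only known for [i < j], hence the extension by zero. *)
pose V e w : R := if e \in edges then \1_(vanishing e) (Y e w) else 0.
have mV e : measurable_fun setT (V e).
  rewrite /V; case: (boolP (e \in edges)) => // eJ.
  apply: measurableT_comp (measurable_edge e eJ).
  exact: measurable_indic (measurable_vanishing e).
have V0 e w : 0 <= V e w by rewrite /V; case: ifP.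
have mprod : measurable_fun setT (fun w => \prod_(e in edges) ratio e (Y e w)).
  exact: measurable_fun_bigprod.
have -> : P E = (\int[P]_w (\1_E w)%:E)%E by rewrite integral_indic// setIT.
apply: (@le_trans _ _ (\int[P]_w ((\prod_(e in edges) ratio e (Y e w))%:E
    + \sum_e (V e w)%:E))%E).
  apply: ge0_le_integral => //.
  - exact/measurable_EFinP/measurable_indic.
  - apply: emeasurable_funD; first exact/measurable_EFinP.
    by apply: emeasurable_sum => e; exact/measurable_EFinP.
  - move=> w _; rewrite sumEFin -EFinD lee_fin -big_mkcond.
    exact: indic_likelihood_le.
rewrite ge0_integralD//; last 4 first.
- by move=> w _; rewrite lee_fin prodr_ge0// => e _; exact: sqrtr_ge0.
- exact/measurable_EFinP.
- by move=> w _; apply: sume_ge0 => e _; rewrite lee_fin.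
- by apply: emeasurable_sum => e; exact/measurable_EFinP.
rewrite ge0_integral_sum//; last 2 first.
- by move=> e; exact/measurable_EFinP.
- by move=> e w _; rewrite lee_fin.
rewrite [X in (_ + X)%E]big1 ?adde0; last first.
  move=> e _; rewrite /V; case: (boolP (e \in edges)) => [|_].
    exact: integral_vanishing.
  by rewrite integral0.
rewrite (@expectation_prod_indep _ _ _ _ _ P _ edges Y _ _ ratio
  (fun e => if (s e.1 == s e.2) != (t e.1 == t e.2) then bhattacharyya mu p q else 1)).
- rewrite lee_fin -big_mkcondr/= prodr_const.
  rewrite le_eqVlt; apply/orP; left; apply/eqP; congr (_ ^+ _).
  by apply: eq_card => e; rewrite [RHS]inE unfold_in/= inE.
- exact: measurable_edge.
- move=> A mA; apply: indW => // e; by rewrite !inE.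
- by move=> e _; exact: measurable_ratio.
- by move=> e x; exact: sqrtr_ge0.
- exact: integral_ratio.
Qed.

End PairwiseError.

(** * Union bound *)

Lemma measure_bigsetU_le {R : realType} {d : measure_display}
    {T : measurableType d} (P : {measure set T -> \bar R}) {I : Type} (s : seq I)
    (Q : pred I) (F : I -> set T) : (forall i, Q i -> measurable (F i)) ->
  (P (\big[setU/set0]_(i <- s | Q i) F i) <= \sum_(i <- s | Q i) P (F i))%E.
Proof.
move=> mF; elim: s => [|i s IH]; first by rewrite !big_nil measure0.
rewrite !big_cons; case: ifPn => // Qi.
apply: (le_trans (measureU2 _ _ _)); [exact: mF|exact: bigsetU_measurable|].
exact: leeD2l.
Qed.

Lemma sume_by_value {R : realType} {I : finType} (Q : pred I) (h : I -> nat)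
    (M : nat) (F : nat -> \bar R) : (forall i, Q i -> 0 < h i <= M)%N ->
  (\sum_(i | Q i) F (h i) =
   \sum_(1 <= m < M.+1) #|[set i | Q i && (h i == m)]%SET|%:R%:E * F m)%E.
Proof.
move=> hQ.
transitivity (\sum_(i | Q i) \sum_(1 <= m < M.+1 | h i == m) F m)%E.
  apply: eq_bigr => i /hQ /andP[h0 hM].
  under [RHS]eq_bigl do rewrite eq_sym.
  by rewrite big_nat1_eq h0 ltnS hM.
rewrite (exchange_big_dep xpredT)//=; apply: eq_bigr => m _.
rewrite mule_natl -sum1dep_card; elim/big_rec2: _ => [|i k y _ ->]; first by [].
by rewrite add1n muleS.
Qed.

Section MleError.
Context {R : realType} {dX : measure_display} {X : measurableType dX}.
Variable mu : {measure set X -> \bar R}.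
Context {d : measure_display} {Omega : measurableType d}.
Variables (P : probability Omega R) (n K : nat).
Variables (W : 'I_(n * K) -> 'I_(n * K) -> Omega -> X) (p q : X -> R).
Variable s0 : 'I_(n * K) -> 'I_K.
Hypothesis model : wsbm mu P W p q s0.

Let beats (t : 'I_(n * K) -> 'I_K) := [set w |
  likelihood p q s0 (fun i j => W i j w) <= likelihood p q t (fun i j => W i j w)].

(* Competitors relabelled so as to be as close as possible to the truth. *)
Let competitor (t : {ffun 'I_(n * K) -> 'I_K}) : bool :=
  [&& [forall k, #|[set i | t i == k]%SET| == n],
      [forall f : {perm 'I_K}, hamming s0 t <= hamming s0 (f \o t)] &
      0 < hamming s0 t]%N.

(** [balanced] counts classical sets, whereas the combinatorial lemmas count finite sets. *)
Lemma card_fiber (t : 'I_(n * K) -> 'I_K) k :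
  balanced t -> #|[set i | t i == k]%SET| = n.
Proof.
move=> bt; transitivity #|[set i | t i == k]|; last exact: bt.
apply: eq_card => i; rewrite inE.
by apply/idP/idP => [h|/set_mem//]; exact: mem_set.
Qed.

Lemma measurable_beats t : measurable (beats t).
Proof. by case: model => _ dp dq dW _; exact: measurable_likelihood_le dp dq dW. Qed.

(** Passing to finite functions makes the failure event a finite union. *)
Lemma measurable_mle_fail : measurable (mle_fail W p q s0).
Proof.
rewrite [X in measurable X](_ : _ = \bigcup_(t in
  [set t : {ffun 'I_(n * K) -> 'I_K} | balanced t /\ ~ same_partition t s0]) beats t).
  apply: fin_bigcup_measurable => [|t _]; first exact: finite_finset.
  exact: measurable_beats.
apply/seteqP; split => [w [s [bs ns le]]|w [t [bt nt] le]]; last by exists t.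
exists (finfun s); first split.
- move=> k; transitivity #|[set i | s i == k]|; last exact: bs.
  apply: eq_card => i.
  by rewrite /in_mem/=; congr asbool; rewrite /mkset ffunE.
- by apply: contra_not ns => h i j; have := h i j; rewrite !ffunE.
- rewrite /beats/= [leRHS](_ : _ = likelihood p q s (fun i j => W i j w))//.
  by apply: eq_bigr => i _; apply: eq_bigr => j _; rewrite !ffunE.
Qed.

(** Relabelling changes neither the likelihood nor the partition, so a winning assignment may be
    replaced by its closest relabelling. Distance zero would mean the true partition. *)
Lemma mle_fail_sub :
  mle_fail W p q s0 `<=` \big[setU/set0]_(t | competitor t) beats t.
Proof.
move=> w [s [bs ns le]]; have [f fopt] := optimal_relabeling s0 s.
pose t := finfun (f \o s).
have te : t =1 f \o s by move=> i; rewrite ffunE.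
have hamt (g : 'I_K -> 'I_K) : hamming s0 (g \o t) = hamming s0 (g \o (f \o s)).
  by apply: eq_card => i; rewrite !inE /= te.
have ct : competitor t.
  apply/and3P; split.
  - apply/forallP => k; apply/eqP.
    transitivity #|[set i | s i == (f^-1)%g k]%SET|; last exact: card_fiber.
    by apply: eq_card => i; rewrite !inE te /= -[RHS](inj_eq (@perm_inj _ f)) permKV.
  - apply/forallP => g; rewrite hamt -[leqLHS]/(hamming s0 (id \o t)) hamt.
    exact: fopt.
  - rewrite lt0n; apply: contra_not_neq ns => /cards0_eq h0 i j.
    have E k : s0 k = f (s k).
      by have := finset.in_set0 k; rewrite -h0 inE te/= => /negbFE/eqP.
    by rewrite !E (inj_eq perm_inj).
rewrite (bigD1 t)//=; left; rewrite /beats/=.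
rewrite [leRHS](_ : _ = likelihood p q s (fun i j => W i j w))//.
apply: eq_bigr => i _; apply: eq_bigr => j _.
by rewrite !te/= (inj_eq perm_inj).
Qed.

(** Union bound over competitors, grouped by distance to the truth; [B] stands for any bound on the
    pairwise error that depends on this distance only. *)
Lemma mle_fail_le (B : nat -> \bar R) :
  (forall t, competitor t ->
    (bhattacharyya mu p q ^+ #|mismatched s0 t|)%:E <= B (hamming s0 t))%E ->
  (forall m, 0 <= B m)%E ->
  (P (mle_fail W p q s0) <= \sum_(1 <= m < (n * K).+1)
    (Num.min ((expR 1 * n%:R * K%:R ^+ 2 / m%:R) ^+ m) (K%:R ^+ (n * K)))%:E * B m)%E.
Proof.
move=> hB B0; have [_ dp dq dW indW] := model.
have mU : measurable (\big[setU/set0]_(t | competitor t) beats t).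
  by apply: bigsetU_measurable => t _; exact: measurable_beats.
apply: (@le_trans _ _ (P (\big[setU/set0]_(t | competitor t) beats t))).
  by apply: le_measure; rewrite ?inE//; [exact: measurable_mle_fail|exact: mle_fail_sub].
apply: (le_trans (measure_bigsetU_le _ _ _ _ _)) => [t _|].
  exact: measurable_beats.
apply: (@le_trans _ _ (\sum_(t | competitor t) B (hamming s0 t))%E).
  apply: lee_sum => t ct; apply: le_trans (hB _ ct).
  exact: pairwise_error dp dq dW indW.
rewrite (sume_by_value _ (fun t : {ffun 'I_(n * K) -> 'I_K} => hamming s0 t)
  (n * K)%N); last first.
  move=> t /and3P[_ _ ->]/=.
  by rewrite (leq_trans (max_card _))// card_ord.
rewrite big_seq [leRHS]big_seq; apply: lee_sum => m.
rewrite mem_index_iota => /andP[m0 _].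
rewrite lee_wpmul2r// lee_fin.
apply: le_trans (card_hamming_sphere_le n K m s0 m0); rewrite ler_nat.
by apply: subset_leq_card; apply/fintype.subsetP => t; rewrite !inE => /andP[].
Qed.

Lemma mle_fail_bound : (0 < K)%N ->
  (P (mle_fail W p q s0) <=
       \sum_(1 <= m < (n./2).+1)
          (Num.min ((expR 1 * n%:R * K%:R ^+ 2 / m%:R) ^+ m) (K%:R ^+ (n * K)))%:E
          * expeR ((m%:R ^+ 2 - n%:R * m%:R)%:E * renyi_half mu p q)
     + \sum_((n./2).+1 <= m < (n * K).+1)
          (Num.min ((expR 1 * n%:R * K%:R ^+ 2 / m%:R) ^+ m) (K%:R ^+ (n * K)))%:E
          * expeR ((- (2 * m%:R * n%:R / 9))%:E * renyi_half mu p q))%E.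
Proof.
move=> K0; have [bs dp dq _ _] := model.
pose B m : \bar R := if (m < (n./2).+1)%N
  then expeR ((m%:R ^+ 2 - n%:R * m%:R)%:E * renyi_half mu p q)
  else expeR ((- (2 * m%:R * n%:R / 9))%:E * renyi_half mu p q).
have B0 m : (0 <= B m)%E by rewrite /B; case: ifP => _; exact: expeR_ge0.
apply: (le_trans (mle_fail_le B _ B0)); last first.
  rewrite (@big_cat_nat _ _ _ (n./2).+1)//=; last first.
    by rewrite ltnS (@leq_trans n)// ?leq_pmulr//; lia.
  rewrite le_eqVlt; apply/orP; left; apply/eqP; congr (_ + _)%E.
    by apply: eq_big_nat => m /andP[_ mn]; rewrite /B mn.
  by apply: eq_big_nat => m /andP[mn _]; rewrite /B ltnNge mn.
move=> t /and3P[/forallP bt /forallP opt h0].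
have bt' k : #|[set i | t i == k]%SET| = n by apply/eqP/bt.
have quad := mismatched_ge_quad _ _ _ s0 t (fun k => card_fiber s0 k bs) bt'.
have third := mismatched_ge_third _ _ _ s0 t (fun k => card_fiber s0 k bs) bt' opt.
have n0 : (0 < n)%N.
  rewrite lt0n; apply: contraTneq h0 => n0.
  by rewrite -leqNgt (leq_trans (max_card _))// card_ord n0.
(* Positivity of the exponent is what the case [b = 0] requires. *)
have M0 : (0 < #|mismatched s0 t|)%N.
  rewrite lt0n; apply: contraTneq third => ->.
  by rewrite muln0 -ltnNge !muln_gt0 n0.
rewrite /B; case: ifP => _.
  rewrite -opprB; apply: exp_bhattacharyya_le => //.
  have : (2 * (n * hamming s0 t))%:R <= (#|mismatched s0 t| + 2 * hamming s0 t ^ 2)%:R :> R.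
    by rewrite ler_nat.
  rewrite !natrD !natrM; lra.
(* [third] gives [M >= 2 n m / 3], which is at least the required [4 n m / 9]. *)
apply: exp_bhattacharyya_le => //.
have : (2 * (n * hamming s0 t))%:R <= (3 * #|mismatched s0 t|)%:R :> R by rewrite ler_nat.
have : 0 <= (n * hamming s0 t)%:R :> R by [].
rewrite !natrM; lra.
Qed.

End MleError.

(** * Asymptotics *)

Lemma limn_einf_gt {R : realType} (u : (\bar R)^nat) (a : R) :
  (a%:E < limn_einf u)%E ->
  exists2 c, a < c & \forall n \near \oo, (c%:E <= u n)%E.
Proof.
rewrite limn_einf_lim (cvg_lim _ (@cvg_einfs_sup _ _))// => /ereal_sup_gt[_ [N _ <-] aN].
have [c ac cN] : exists2 c, a < c & (c%:E <= einfs u N)%E.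
  case: (einfs u N) aN => [r| |]//.
    by rewrite lte_fin => ar; exists r.
  (* An infinite tail infimum admits any real [c] above [a]. *)
  by move=> _; exists (a + 1); rewrite ?ltrDl// leey.
exists c => //; exists N => // n /= Nn; apply: (le_trans cN).
by apply: ereal_inf_lbound; exists n.
Qed.

(** The exponential is [n ^ (- eta)], so the bound holds once [n >= (A / eps) ^ (1 / eta)]. *)
Lemma expR_ln_small {R : realType} (A eta eps : R) : 0 < A -> 0 < eta -> 0 < eps ->
  \forall n \near \oo, A * expR (- eta * ln n%:R) <= eps.
Proof.
move=> A0 eta0 eps0; near=> n.
have n0 : 0 < n%:R :> R by rewrite ltr0n; near: n; exact: nbhs_infty_gt.
rewrite -ler_pdivlMl// -[leRHS]lnK ?posrE ?mulr_gt0 ?invr_gt0// ler_expR.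
rewrite mulNr -[leRHS]opprK lerN2 [eta * _]mulrC -ler_pdivrMr// -ler_expR lnK ?posrE//.
near: n; exact: nbhs_infty_ger.
Unshelve. all: by end_near. Qed.

Lemma sum_pow_le {R : realType} (r : R) (M : nat) : 0 <= r -> r <= 1 / 2 ->
  \sum_(1 <= m < M.+1) r ^+ m <= 2 * r.
Proof.
(* The subtracted term [2 r ^ (M + 1)] makes the induction close for [r <= 1 / 2]. *)
move=> r0 r2; suff h : \sum_(1 <= m < M.+1) r ^+ m <= 2 * r - 2 * (r ^+ M * r).
  by apply: le_trans h _; rewrite gerBl !mulr_ge0// exprn_ge0.
elim: M => [|M IH]; first by rewrite big_geq// expr0; lra.
rewrite big_nat_recr//= (le_trans (lerD IH (lexx _)))//.
have := exprn_ge0 M r0; rewrite exprS; set x := r ^+ M => x0.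
have : 0 <= x * r by rewrite mulr_ge0.
nra.
Qed.

(* [-(m n g)] is the exponent of a term of the union bound; [g] is [1 - m/n] or [2/9]. *)
Lemma union_term_le {R : realType} (n K m : nat) (c g A eta y : R) (I : \bar R) :
  (0 < m)%N -> (0 < n)%N -> 0 <= g ->
  ((c * ln n%:R / n%:R)%:E <= I)%E ->
  n%:R / m%:R * expR (- (g * c * ln n%:R)) <= A * expR (- eta * ln n%:R) ->
  ((Num.min ((expR 1 * n%:R * K%:R ^+ 2 / m%:R) ^+ m) y)%:E
    * expeR ((- (m%:R * n%:R * g))%:E * I) <=
   ((expR 1 * K%:R ^+ 2 * A * expR (- eta * ln n%:R)) ^+ m)%:E)%E.
Proof.
move=> m0 n0 g0 hI hA.
have nR : n%:R != 0 :> R by rewrite pnatr_eq0 -lt0n.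
have E : (expeR ((- (m%:R * n%:R * g))%:E * I) <= (expR (- (g * c * ln n%:R)) ^+ m)%:E)%E.
  rewrite -expRM_natl -[leRHS]/(expeR (m%:R * - (g * c * ln n%:R))%:E) lee_expeR.
  have -> : m%:R * - (g * c * ln n%:R) = - (m%:R * n%:R * g) * (c * ln n%:R / n%:R) :> R.
    by field.
  by rewrite EFinM EFinN !mulNe leeN2 lee_wpmul2l// lee_fin !mulr_ge0.
(* Bounding the minimum by its first argument makes both factors [m]-th powers. *)
apply: (@le_trans _ _ ((expR 1 * n%:R * K%:R ^+ 2 / m%:R) ^+ m *
    expR (- (g * c * ln n%:R)) ^+ m)%:E).
  rewrite EFinM; apply: (@le_trans _ _ (((expR 1 * n%:R * K%:R ^+ 2 / m%:R) ^+ m)%:E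
    * expeR ((- (m%:R * n%:R * g))%:E * I))%E).
    by rewrite lee_wpmul2r ?expeR_ge0// lee_fin ge_min lexx.
  by rewrite lee_wpmul2l// lee_fin exprn_ge0.
have e0 : 0 <= expR 1 * K%:R ^+ 2 :> R by rewrite mulr_ge0 ?expR_ge0 ?exprn_ge0.
rewrite lee_fin -exprMn; apply: lerXn2r.
- by rewrite nnegrE !mulr_ge0 ?invr_ge0 ?expR_ge0 ?exprn_ge0.
- rewrite nnegrE -mulrA mulr_ge0//; apply: le_trans hA.
  by rewrite !mulr_ge0 ?invr_ge0 ?expR_ge0.
- have := ler_wpM2l e0 hA; rewrite !mulrA => h; apply: le_trans h.
  by rewrite le_eqVlt; apply/orP; left; apply/eqP; ring.
Qed.

Section Exponents.
Context {R : realType}.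
Variables (n m : nat) (c : R).
Hypotheses (c1 : 1 < c) (n1 : (0 < n)%N) (m0 : (0 < m)%N).

(** The threshold satisfies [delta * c = (c - 1) / 2], half of the slack in [c > 1]. In [A], the
    summand [delta^-1] bounds [n / m] for [m > delta n], and 2 bounds it for [m > n / 2]. *)
Let delta := (c - 1) / (2 * c).
Let eta := Num.min ((c - 1) / 2) (2 / 9).
Let A := delta^-1 + 2.

Lemma exponent_gt0 : [/\ 0 < delta, 0 < eta & 0 < A].
Proof.
have d0 : 0 < delta by rewrite divr_gt0 ?subr_gt0// mulr_gt0// (lt_trans _ c1).
split => //; first by rewrite lt_min !divr_gt0 ?subr_gt0.
by rewrite /A addr_gt0 ?invr_gt0.
Qed.

Lemma ln_natr_ge0 : 0 <= ln n%:R :> R.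
Proof. by rewrite ln_ge0// ler1n. Qed.

Lemma small_m_exponent : (m <= n./2)%N ->
  n%:R / m%:R * expR (- ((1 - m%:R / n%:R) * c * ln n%:R)) <= A * expR (- eta * ln n%:R).
Proof.
have [d0 eta0 A0] := exponent_gt0; have L0 := ln_natr_ge0.
move=> mn; have n0 : 0 < n%:R :> R by rewrite ltr0n.
have m0' : 0 < m%:R :> R by rewrite ltr0n.
have eta1 : eta <= (c - 1) / 2 by rewrite ge_min lexx.
have eta2 : eta <= 2 / 9 by rewrite ge_min lexx orbT.
have mn2 : m%:R / n%:R <= 1 / 2 :> R.
  rewrite ler_pdivrMr//.
  have : (2 * m)%:R <= n%:R :> R by rewrite ler_nat; lia.
  by rewrite natrM; lra.
have [md|md] := leP (m%:R / n%:R) delta.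
  apply: (@le_trans _ _ (1 * expR (- eta * ln n%:R))); last first.
    rewrite ler_wpM2r ?expR_ge0// /A.
    have : 0 < delta^-1 by rewrite invr_gt0.
    by move: delta^-1 => z; lra.
  apply: (@le_trans _ _ (n%:R * expR (- ((1 - m%:R / n%:R) * c * ln n%:R)))).
    by rewrite ler_wpM2r ?expR_ge0// ler_pdivrMr// ler_peMr ?ler1n// ltW.
  rewrite -{1}[n%:R]lnK ?posrE// -expRD mul1r ler_expR.
  have : delta * c = (c - 1) / 2 by rewrite /delta; field; lra.
  move=> dc; have xc : m%:R / n%:R * c <= (c - 1) / 2.
    by rewrite -dc ler_wpM2r//; lra.
  have : 0 <= ((1 - m%:R / n%:R) * c - 1 - eta) * ln n%:R.
    by rewrite mulr_ge0//; lra.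
  lra.
apply: ler_pM; rewrite ?expR_ge0 ?divr_ge0//.
  rewrite -[n%:R / _]invf_div (@le_trans _ _ delta^-1)//.
    have mn0 : 0 < m%:R / n%:R :> R by rewrite divr_gt0.
    by rewrite lef_pV2 ?posrE// ltW.
  by rewrite /A lerDl.
rewrite ler_expR mulNr lerN2 ler_wpM2r//.
nra.
Qed.

Lemma large_m_exponent : (n./2 < m)%N ->
  n%:R / m%:R * expR (- ((2 / 9) * c * ln n%:R)) <= A * expR (- eta * ln n%:R).
Proof.
have [d0 eta0 A0] := exponent_gt0; have L0 := ln_natr_ge0.
move=> mn; have n0 : 0 < n%:R :> R by rewrite ltr0n.
have m0' : 0 < m%:R :> R by rewrite ltr0n.
have eta2 : eta <= 2 / 9 by rewrite ge_min lexx orbT.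
apply: ler_pM; rewrite ?expR_ge0 ?divr_ge0//.
  apply: (@le_trans _ _ 2); last by rewrite /A lerDr invr_ge0 ltW.
  rewrite ler_pdivrMr//.
  by have : n%:R <= (2 * m)%:R :> R; [rewrite ler_nat; lia|rewrite natrM].
rewrite ler_expR mulNr lerN2 ler_wpM2r//.
by rewrite (le_trans eta2)// ler_peMr// ltW.
Qed.

End Exponents.

Lemma union_exponents {R : realType} (c : R) : 1 < c ->
  exists A eta : R, [/\ 0 < A, 0 < eta & forall n m : nat, (0 < n)%N -> (0 < m)%N ->
    n%:R / m%:R * expR (- ((if (m <= n./2)%N then 1 - m%:R / n%:R else 2 / 9) * c
      * ln n%:R)) <= A * expR (- eta * ln n%:R)].
Proof.
move=> c1; have [d0 eta0 A0] := exponent_gt0 c c1.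
eexists; eexists; split; [exact: A0|exact: eta0|] => n m n0 m0.
case: leqP => mn; first exact: small_m_exponent.
exact: large_m_exponent.
Qed.

Lemma renyi_half_lower {R : realType} (n : nat) (c : R) (I : \bar R) : (1 < n)%N ->
  (c%:E <= n%:R%:E * I * ((ln n%:R)^-1)%:E)%E -> ((c * ln n%:R / n%:R)%:E <= I)%E.
Proof.
move=> n1; have n0 : 0 < n%:R :> R by rewrite ltr0n ltnW.
have L0 : 0 < ln n%:R :> R by rewrite ln_gt0// ltr1n.
case: I => [r| |]; last by rewrite gt0_muleNy ?lte_fin// gt0_mulNye ?lte_fin ?invr_gt0.
  by rewrite -!EFinM !lee_fin ler_pdivlMr// ler_pdivrMr// [r * _]mulrC.
by move=> _; rewrite leey.
Qed.

Lemma mle_fail_rate {R : realType} {dX : measure_display} {X : measurableType dX}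
    (mu : {measure set X -> \bar R}) {d : measure_display} {Omega : measurableType d}
    (P : probability Omega R) (n K : nat) (W : 'I_(n * K) -> 'I_(n * K) -> Omega -> X)
    (p q : X -> R) (s0 : 'I_(n * K) -> 'I_K) (c A eta r : R) :
  wsbm mu P W p q s0 -> (0 < K)%N -> (0 < n)%N ->
  r = expR 1 * K%:R ^+ 2 * A * expR (- eta * ln n%:R) -> 0 <= r <= 1 / 2 ->
  ((c * ln n%:R / n%:R)%:E <= renyi_half mu p q)%E ->
  (forall m, (0 < m)%N -> n%:R / m%:R *
    expR (- ((if (m <= n./2)%N then 1 - m%:R / n%:R else 2 / 9) * c * ln n%:R))
    <= A * expR (- eta * ln n%:R)) ->
  (P (mle_fail W p q s0) <= (2 * r)%:E)%E.
Proof.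
move=> model K0 n0 rE /andP[r0 r2] hI hA.
have nR : n%:R != 0 :> R by rewrite pnatr_eq0 -lt0n.
apply: (le_trans (mle_fail_bound _ _ _ _ _ _ _ _ model K0)).
apply: (@le_trans _ _ (\sum_(1 <= m < (n * K).+1) (r ^+ m)%:E)%E); last first.
  by rewrite sumEFin lee_fin sum_pow_le.
rewrite [leRHS](@big_cat_nat _ _ _ (n./2).+1)//=; last first.
  by rewrite ltnS (@leq_trans n)// ?leq_pmulr//; lia.
rewrite leeD//.
- rewrite big_seq [leRHS]big_seq; apply: lee_sum => m.
  rewrite mem_index_iota => /andP[m0 mn].
  have := hA m m0; rewrite ltnS in mn; rewrite mn => hm.
  have -> : m%:R ^+ 2 - n%:R * m%:R = - (m%:R * n%:R * (1 - m%:R / n%:R)) :> R by field.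
  rewrite rE; apply: union_term_le hm => //.
  rewrite subr_ge0 ler_pdivrMr ?ltr0n// mul1r ler_nat; lia.
- rewrite big_seq [leRHS]big_seq; apply: lee_sum => m.
  rewrite mem_index_iota => /andP[mn _].
  have m0 : (0 < m)%N by apply: leq_trans mn.
  have := hA m m0; rewrite leqNgt mn => /= hm.
  have -> : 2 * m%:R * n%:R / 9 = m%:R * n%:R * (2 / 9) :> R by field.
  by rewrite rE; apply: union_term_le hm.
Qed.

Lemma mle_success_cvg {R : realType} {dX : measure_display} {X : measurableType dX}
    (mu : {measure set X -> \bar R}) (K : nat) (d : nat -> measure_display)
    (Omega : forall n, measurableType (d n)) (P : forall n, probability (Omega n) R)
    (W : forall n, 'I_(n * K) -> 'I_(n * K) -> Omega n -> X) (p q : nat -> X -> R)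
    (s0 : forall n, 'I_(n * K) -> 'I_K) :
  (0 < K)%N -> (forall n, wsbm mu (P n) (W n) (p n) (q n) (s0 n)) ->
  (1 < limn_einf (fun n : nat =>
          (n%:R)%:E * renyi_half mu (p n) (q n) * ((ln (n%:R : R))^-1)%:E))%E ->
  (fun n => fine (P n (~` mle_fail (W n) (p n) (q n) (s0 n)))) @ \oo --> (1 : R).
Proof.
move=> K0 model /limn_einf_gt[c c1 hc].
have [A [eta [A0 eta0 hA]]] := union_exponents c c1.
pose r n := expR 1 * K%:R ^+ 2 * A * expR (- eta * ln n%:R) : R.
have C0 : 0 < expR 1 * K%:R ^+ 2 * A.
  by rewrite !mulr_gt0 ?expR_gt0 ?exprn_gt0 ?ltr0n.
apply/cvgrPdist_le => eps eps0; near=> n.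
have n1 : (1 < n)%N by near: n; exact: nbhs_infty_gt.
have mF := measurable_mle_fail _ _ _ _ _ _ _ _ (model n).
(* The bound 1/2 serves the geometric sum, and [eps / 2] makes [2 * r n] at most [eps]. *)
have rle : r n <= Num.min (1 / 2) (eps / 2).
  near: n; apply: expR_ln_small => //.
  by rewrite lt_min !divr_gt0.
have : (P n (mle_fail (W n) (p n) (q n) (s0 n)) <= (2 * r n)%:E)%E.
  apply: (mle_fail_rate _ _ _ _ _ _ _ _ c A eta (r n) (model n)) => //.
  - exact: ltnW.
  - rewrite (le_trans rle) ?ge_min ?lexx// andbT.
    by rewrite mulr_ge0 ?expR_ge0 ?ltW.
  - by apply: renyi_half_lower => //; near: n.
  - by move=> m m0; apply: hA => //; exact: ltnW.
rewrite probability_setC// -[P n _]fineK ?fin_num_measure// -EFinB lee_fin /= => h.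
have f0 : 0 <= fine (P n (mle_fail (W n) (p n) (q n) (s0 n))) by apply: fine_ge0.
rewrite opprB addrC subrK ger0_norm// (le_trans h)//.
by move: rle; rewrite le_min => /andP[_]; lra.
Unshelve. all: by end_near. Qed.

Theorem theorem2 (R : realType) (dX : measure_display) (X : measurableType dX)
    (mu : {measure set X -> \bar R}) (K : nat) (hK : (2 <= K)%N) :
  (forall (n : nat) (d : measure_display) (Omega : measurableType d)
      (P : probability Omega R) (W : 'I_(n * K) -> 'I_(n * K) -> Omega -> X)
      (p q : X -> R) (sigma0 : 'I_(n * K) -> 'I_K),
    wsbm mu P W p q sigma0 ->
    (P (mle_fail W p q sigma0) <=
       \sum_(1 <= m < (n./2).+1)
          (Num.min ((expR 1 * n%:R * K%:R ^+ 2 / m%:R) ^+ m) (K%:R ^+ (n * K)))%:E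
          * expeR ((m%:R ^+ 2 - n%:R * m%:R)%:E * renyi_half mu p q)
     + \sum_((n./2).+1 <= m < (n * K).+1)
          (Num.min ((expR 1 * n%:R * K%:R ^+ 2 / m%:R) ^+ m) (K%:R ^+ (n * K)))%:E
          * expeR ((- (2 * m%:R * n%:R / 9))%:E * renyi_half mu p q))%E)
  /\
  (forall (d : nat -> measure_display) (Omega : forall n, measurableType (d n))
      (P : forall n, probability (Omega n) R)
      (W : forall n, 'I_(n * K) -> 'I_(n * K) -> Omega n -> X)
      (p q : nat -> X -> R) (sigma0 : forall n, 'I_(n * K) -> 'I_K),
    (forall n, wsbm mu (P n) (W n) (p n) (q n) (sigma0 n)) ->
    (1 < limn_einf (fun n : nat =>
            (n%:R)%:E * renyi_half mu (p n) (q n) * ((ln (n%:R : R))^-1)%:E))%E ->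
    (fun n => fine (P n (~` mle_fail (W n) (p n) (q n) (sigma0 n)))) @ \oo
      --> (1 : R)).
Proof.
have K0 : (0 < K)%N by apply: leq_trans hK.
split => [n d Omega P W p q sigma0 model|d Omega P W p q sigma0 model].
  exact: mle_fail_bound model K0.
exact: mle_success_cvg.
Qed.
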